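(* Let $\mathcal V=\{1,\dots,n\}$, let $X\subset\mathbb R^m$ be a nonempty compact convex set, and let $f_i:\mathbb R^m\to\mathbb R$ ($i\in\mathcal V$) be convex on an open convex set $U_i\supset X$. Suppose there is $L>0$ with $|d|\le L$ for all $d\in\partial f_i(x)$, $x\in X$, $i\in\mathcal V$. Let the stepsizes $\alpha_k>0$ be non-increasing in $k$ and satisfy $\sum_{k=0}^\infty\alpha_k=\infty$ and $\sum_{k=0}^\infty\alpha_k^2<\infty$. Let $p\ge 2$, let $A_1,\dots,A_p\in\mathbb R^{n\times n}$, and let the weight matrices switch periodically: $A(tp+l-1)=A_l$ for all $t\in\mathbb N$ and $l\in\{1,\dots,p\}$. Suppose that the sequence $\{A(k)\}$ satisfies the weight rule and that its associated graph sequence is uniformly jointly strongly connected. Let $\mu^1,\mu^2,\dots,\mu^p$ be the Perron vectors of $$A_pA_{p-1}\cdots A_1,\quad A_{p-1}A_{p-2}\cdots A_1A_p,\quad\dots,\quad A_1A_pA_{p-1}\cdots A_2,$$ respectively (that is, $\mu^l$ is the Perron vector of $A_{p-l+1}A_{p-l}\cdots A_1A_pA_{p-1}\cdots A_{p-l+2}$), and let $\mu^l_i$ be the $i$-th entry of $\mu^l$. Then the distributed projected subgradient algorithm with weight matrices $A(k)$ achieves a solution to $$\min_{x\in X}\ \sum_{i\in\mathcal V}\frac1p\big(\mu^1_i+\dots+\mu^p_i\big)f_i(x).$$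
   Context: $\mathbb N$ is the set of nonnegative integers, $|\cdot|$ is the Euclidean norm, and $x'$ denotes transpose. For $x\in U_i$, $\partial f_i(x)$ is the set of $g\in\mathbb R^m$ such that $f_i(y)-f_i(x)\ge (y-x)'g$ for all $y\in U_i$. $P_X(x)$ is the unique point of $X$ nearest to $x$ in Euclidean norm. The graph associated with a nonnegative matrix $A=[a_{ij}]$ has node set $\mathcal V$ and a directed edge $(j,i)$ if and only if $a_{ij}>0$; it is strongly connected if there is a directed path from every node to every other node. If $A$ is row stochastic with strongly connected graph, its Perron vector $\mu(A)$ is the unique vector with positive entries summing to $1$ such that $\mu(A)'A=\mu(A)'$. Weight rule for $A(k)=[a_{ij}(k)]$: each $A(k)$ is nonnegative with $\sum_{j\in\mathcal V}a_{ij}(k)=1$ for all $i$ and $k$ (row stochastic), and there is $0<\eta<1$ (independent of $k$) such that $a_{ij}(k)\ge\eta$ whenever $a_{ij}(k)>0$ and $a_{ii}(k)\ge\eta$ for all $i,j\in\mathcal V$, $k\in\mathbb N$. Uniformly jointly strongly connected (UJSC): there is an integer $B>0$ such that for every $k\in\mathbb N$ the graph on $\mathcal V$ whose edge set is the union of the edge sets of the graphs associated with $A(k),\dots,A(k+B-1)$ is strongly connected. Distributed projected subgradient algorithm: each agent $i\in\mathcal V$ starts from $x_i(0)\in\mathbb R^m$ and, for $k\in\mathbb N$, $$v_i(k)=\sum_{j\in\mathcal V}a_{ij}(k)x_j(k),\qquad x_i(k+1)=P_X\big(v_i(k)-\alpha_k d_i(k)\big),\qquad d_i(k)\in\partial f_i(v_i(k)).$$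 The algorithm achieves a solution to $\min_{x\in X}F(x)$ if for every initial condition and every sequences generated by the recursion, $\lim_{k\to\infty}|x_i(k)-x_j(k)|=0$ for all $i,j\in\mathcal V$, and there is a minimizer $x^*$ of $F$ over $X$ with $\lim_{k\to\infty}|x_i(k)-x^*|=0$ for all $i\in\mathcal V$. *)

(* Defs.v *)
(* MathComp / MathComp-Analysis, over an abstract [R : realType]. *)
From HB Require Import structures.
From mathcomp Require Export all_boot all_order all_algebra.
From mathcomp Require Export all_classical all_reals all_analysis.
Export Order.TTheory GRing.Theory Num.Theory.
Export numFieldNormedType.Exports.

Set Implicit Arguments.
Unset Strict Implicit.
Unset Printing Implicit Defensive.

Global Open Scope classical_set_scope.
Global Open Scope ring_scope.

(* Vectors are row vectors, so that x'y is [dotv x y] and x'M is [x *m M]. *)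
Definition dotv (R : realType) (m : nat) (x y : 'rV[R]_m) : R :=
  \sum_(c < m) x 0 c * y 0 c.

(* The library norm on matrices is the sup norm, hence this definition; both
   norms induce the topology used by [compact] and [open]. *)
Definition enorm (R : realType) (m : nat) (x : 'rV[R]_m) : R :=
  Num.sqrt (dotv x x).

(* The formula is also used as it stands at points [x] outside [U]. *)
Definition subdifferential (R : realType) (m : nat) (U : set 'rV[R]_m)
    (f : 'rV[R]_m -> R) (x : 'rV[R]_m) : set 'rV[R]_m :=
  [set g | forall y, U y -> f y - f x >= dotv (y - x) g].

(* For [X] nonempty, closed and convex the set below is a singleton; otherwise
   [xget] may return its default value [0]. *)
Definition proj (R : realType) (m : nat) (X : set 'rV[R]_m) (x : 'rV[R]_m) :
    'rV[R]_m :=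
  xget 0 [set p | X p /\ forall q, X q -> enorm (x - p) <= enorm (x - q)].

(* [edge A j i] : there is a directed edge (j, i), from j to i. *)
Definition edge (R : realType) (n : nat) (A : 'M[R]_n) : rel 'I_n :=
  fun j i => 0 < A i j.

Definition strongly_connected (n : nat) (e : rel 'I_n) : Prop :=
  forall i j, connect e i j.

Definition row_stochastic (R : realType) (n : nat) (A : 'M[R]_n) : Prop :=
  (forall i j, 0 <= A i j) /\ (forall i, \sum_j A i j = 1).

(* Such a vector exists and is unique when [A] is row stochastic with strongly
   connected graph. *)
Definition is_perron_vector (R : realType) (n : nat) (A : 'M[R]_n)
    (mu : 'rV[R]_n) : Prop :=
  [/\ forall i, 0 < mu 0 i, \sum_i mu 0 i = 1 & mu *m A = mu].

Definition weight_rule (R : realType) (n : nat) (A : nat -> 'M[R]_n) : Prop :=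
  (forall k, row_stochastic (A k)) /\
  exists eta : R, 0 < eta < 1 /\
    forall k, (forall i j, 0 < A k i j -> eta <= A k i j) /\
              (forall i, eta <= A k i i).

Definition UJSC (R : realType) (n : nat) (A : nat -> 'M[R]_n) : Prop :=
  exists B : nat, (0 < B)%N /\
    forall k, strongly_connected
                (fun j i => [exists s : 'I_B, edge (A (k + s)%N) j i]).

(* M_b M_(b-1) ... M_a, with decreasing indices; the identity if b < a. *)
Definition desc_prod (R : realType) (n : nat) (M : nat -> 'M[R]_n)
    (a b : nat) : 'M[R]_n :=
  \big[mulmx/1%:M]_(i <- rev (index_iota a b.+1)) M i.

(* M_(p-l+1) M_(p-l) ... M_1 M_p M_(p-1) ... M_(p-l+2), for 1 <= l <= p. *)
Definition cyclic_prod (R : realType) (n : nat) (M : nat -> 'M[R]_n)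
    (p l : nat) : 'M[R]_n :=
  desc_prod M 1 (p - l + 1) *m desc_prod M (p - l + 2) p.

(* [x k i], [v k i], [d k i] stand for x_i(k), v_i(k), d_i(k). *)
Definition generated (R : realType) (m n : nat) (X : set 'rV[R]_m)
    (U : 'I_n -> set 'rV[R]_m) (f : 'I_n -> 'rV[R]_m -> R)
    (alpha : nat -> R) (A : nat -> 'M[R]_n)
    (x v d : nat -> 'I_n -> 'rV[R]_m) : Prop :=
  forall k i,
    [/\ v k i = \sum_j A k i j *: x k j,
        subdifferential (U i) (f i) (v k i) (d k i) &
        x k.+1 i = proj X (v k i - alpha k *: d k i)].

Definition minimizer (R : realType) (m : nat) (X : set 'rV[R]_m)
    (F : 'rV[R]_m -> R) (z : 'rV[R]_m) : Prop :=
  X z /\ forall y, X y -> F z <= F y.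

(* The algorithm run on [X], [U], [f], [alpha], [A] achieves a solution to
   min_(x in X) F(x). *)
Definition achieves_solution (R : realType) (m n : nat) (X : set 'rV[R]_m)
    (U : 'I_n -> set 'rV[R]_m) (f : 'I_n -> 'rV[R]_m -> R)
    (alpha : nat -> R) (A : nat -> 'M[R]_n) (F : 'rV[R]_m -> R) : Prop :=
  forall x v d : nat -> 'I_n -> 'rV[R]_m,
    generated X U f alpha A x v d ->
    (forall i j, enorm (x k i - x k j) @[k --> \oo] --> (0 : R)) /\
    exists z, minimizer X F z /\
      forall i, enorm (x k i - z) @[k --> \oo] --> (0 : R).

(* Main.v *)
(** The Perron vectors, indexed by phase, give row vectors [pi k] with
    [pi (k + 1) A(k) = pi k].  Hence
    [V k = \sum_i pi_i(k) |x_i(k) - z|^2] is not increased by the mixing step, and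
    a projected subgradient step decreases it by
    [2 alpha_k \sum_i pi_i(k + 1) (f_i(v_i(k)) - f_i(z))] up to [alpha_k^2 L^2].
    Time is cut into blocks whose length [T] is a multiple of [p] and such that
    the transition matrix over one block is positive.  Over a block the spread
    [D] of the agents satisfies [D(t+1) <= rho D(t) + K a(t)] with [rho < 1] and
    [a(t) = alpha_(tT)], so [\sum D^2] is finite.  Evaluating all [f_i] at the
    position of one agent at the start of the block costs [O(a^2 + D^2)],
    freezing the stepsize costs [O(a(t) - a(t+1))], and the weights [pi] average
    over the block to those of the objective [F]; therefore
    [V((t+1)T) <= V(tT) - 2 T a(t) (F(y_t) - F(z)) + e_t] with [e] summable.
    As [\sum a] diverges, [F(y_t)] comes arbitrarily close to the minimum, a
    cluster point [z] of such [y_t] is a minimizer, and the inequality for this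
    [z] gives convergence. *)
Require Import Defs.
From mathcomp Require Import ring lra zify.

Set Implicit Arguments.
Unset Strict Implicit.
Unset Printing Implicit Defensive.

(** * Euclidean norm, projection and subgradients *)

Section EuclideanNorm.
Context {R : realType} {m : nat}.
Implicit Types (x y z g : 'rV[R]_m) (a : R).

Lemma dotvC x y : dotv x y = dotv y x.
Proof. by apply: eq_bigr => c _; rewrite mulrC. Qed.

Lemma dotvDl x y z : dotv (x + y) z = dotv x z + dotv y z.
Proof. by rewrite -big_split; apply: eq_bigr => c _; rewrite mxE mulrDl. Qed.

Lemma dotvZl a x z : dotv (a *: x) z = a * dotv x z.
Proof. by rewrite mulr_sumr; apply: eq_bigr => c _; rewrite mxE mulrA. Qed.

Lemma dotvNl x z : dotv (- x) z = - dotv x z.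
Proof. by rewrite -scaleN1r dotvZl mulN1r. Qed.

Lemma dotvDr x y z : dotv z (x + y) = dotv z x + dotv z y.
Proof. by rewrite dotvC dotvDl !(dotvC z). Qed.

Lemma dotvZr a x z : dotv z (a *: x) = a * dotv z x.
Proof. by rewrite dotvC dotvZl dotvC. Qed.

Lemma dotvNr x z : dotv z (- x) = - dotv z x.
Proof. by rewrite dotvC dotvNl dotvC. Qed.

Lemma dot0v x : dotv 0 x = 0.
Proof. by rewrite -(scale0r 0) dotvZl mul0r. Qed.

Definition dotvE := (dotvDl, dotvDr, dotvNl, dotvNr, dotvZl, dotvZr).

Lemma dotv_ge0 x : 0 <= dotv x x.
Proof. by apply: sumr_ge0 => c _; rewrite -expr2 sqr_ge0. Qed.

Lemma enorm_ge0 x : 0 <= enorm x.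
Proof. exact: sqrtr_ge0. Qed.

Lemma sqr_enorm x : enorm x ^+ 2 = dotv x x.
Proof. by rewrite sqr_sqrtr// dotv_ge0. Qed.

Lemma enormZ a x : enorm (a *: x) = `|a| * enorm x.
Proof.
by rewrite /enorm dotvZl dotvZr mulrA -expr2 sqrtrM ?sqr_ge0// sqrtr_sqr.
Qed.

Lemma enormN x : enorm (- x) = enorm x.
Proof. by rewrite -scaleN1r enormZ normrN1 mul1r. Qed.

Lemma enormB x y : enorm (x - y) = enorm (y - x).
Proof. by rewrite -enormN opprB. Qed.

Lemma enorm0 : enorm (0 : 'rV[R]_m) = 0.
Proof. by rewrite /enorm dot0v sqrtr0. Qed.

Lemma coord_le_enorm x (c : 'I_m) : `|x 0 c| <= enorm x.
Proof.
rewrite -sqrtr_sqr ler_sqrt ?dotv_ge0// /dotv (bigD1 c)//= -expr2 lerDl.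
by apply: sumr_ge0 => i _; rewrite -expr2 sqr_ge0.
Qed.

Lemma enorm_eq0 x : enorm x = 0 -> x = 0.
Proof.
move=> x0; apply/rowP => c; rewrite mxE; apply/eqP.
by rewrite -normr_le0 -x0 coord_le_enorm.
Qed.

Lemma cauchy_schwarz x y : dotv x y <= enorm x * enorm y.
Proof.
have [/enorm_eq0->|x0] := eqVneq (enorm x) 0; first by rewrite dot0v enorm0 mul0r.
have [/enorm_eq0->|y0] := eqVneq (enorm y) 0.
  by rewrite dotvC dot0v enorm0 mulr0.
have xy0 : 0 < enorm x * enorm y by rewrite mulr_gt0// lt0r ?x0 ?y0 enorm_ge0.
have := dotv_ge0 (enorm y *: x - enorm x *: y).
rewrite !dotvE (dotvC y x) -!sqr_enorm => h.
by rewrite -(ler_pM2l xy0); lra.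
Qed.

Lemma enormD x y : enorm (x + y) <= enorm x + enorm y.
Proof.
have xy0 : 0 <= enorm x + enorm y by rewrite addr_ge0 ?enorm_ge0.
rewrite -(ger0_norm xy0) -sqrtr_sqr ler_sqrt ?sqr_ge0//.
rewrite !dotvE (dotvC y x) -!sqr_enorm.
by have := cauchy_schwarz x y; lra.
Qed.

Lemma enorm_triangle y x z : enorm (x - z) <= enorm (x - y) + enorm (y - z).
Proof. by rewrite -[x - z](subrKA y) enormD. Qed.

Lemma enorm_sum {I : Type} (r : seq I) (P : pred I) (x : I -> 'rV[R]_m) :
  enorm (\sum_(i <- r | P i) x i) <= \sum_(i <- r | P i) enorm (x i).
Proof.
elim/big_ind2 : _ => [|u a v b ua vb|//]; first by rewrite enorm0.
by rewrite (le_trans (enormD _ _)) ?lerD.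
Qed.

Lemma dotv_delta x (c : 'I_m) : dotv x (delta_mx 0 c) = x 0 c.
Proof.
rewrite /dotv (bigD1 c)//= big1 => [|i /negPf ic]; last first.
  by rewrite !mxE ic !(mulr0, andbF).
by rewrite !mxE !eqxx mulr1 addr0.
Qed.

Lemma enorm_delta (c : 'I_m) : enorm (delta_mx 0 c : 'rV[R]_m) = 1.
Proof. by rewrite /enorm dotv_delta mxE !eqxx sqrtr1. Qed.

Lemma enorm_le_norm x : enorm x <= m%:R * `|x|.
Proof.
rewrite [x in enorm x]row_sum_delta (le_trans (enorm_sum _ _ _))//.
rewrite -[m in m%:R]card_ord mulr_natl -sumr_const ler_sum// => c _.
rewrite enormZ enorm_delta mulr1.
by rewrite [leRHS]mx_normrE; apply: (le_bigmax _ (fun ij => `|x ij.1 ij.2|) (0, c)).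
Qed.

(** Variance identity: the right side exceeds the left by the weighted sum of [|x i - v|^2], with
    [v] the average. *)
Lemma enorm_convex_sum {I : finType} (a : I -> R) (x : I -> 'rV[R]_m) z :
  (forall i, 0 <= a i) -> \sum_i a i = 1 ->
  enorm (\sum_i a i *: x i - z) ^+ 2 <= \sum_i a i * enorm (x i - z) ^+ 2.
Proof.
move=> a0 a1; set v := \sum_i _.
have dv y : dotv v y = \sum_i a i * dotv (x i) y.
  rewrite /v; elim/big_ind2 : _ => [|u b w c <- <-|i _]; first by rewrite dot0v.
    by rewrite dotvDl.
  by rewrite dotvZl.
have sumE y : \sum_i a i * enorm (x i - y) ^+ 2 =
    \sum_i a i * dotv (x i) (x i) - 2 * dotv v y + dotv y y.
  rewrite dv -[dotv y y]mul1r -[X in X * dotv y y]a1 mulr_suml mulr_sumr.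
  rewrite -sumrB -big_split.
  by apply: eq_bigr => i _; rewrite sqr_enorm !dotvE (dotvC y) /=; ring.
have : 0 <= \sum_i a i * enorm (x i - v) ^+ 2.
  by apply: sumr_ge0 => i _; rewrite mulr_ge0// sqr_ge0.
by rewrite !sumE sqr_enorm !dotvE (dotvC z); lra.
Qed.

Lemma enorm_convex_le {I : finType} (a : I -> R) (x : I -> 'rV[R]_m) z (B : R) :
  (forall i, 0 <= a i) -> \sum_i a i = 1 ->
  (forall i, enorm (x i - z) <= B) -> enorm (\sum_i a i *: x i - z) <= B.
Proof.
move=> a0 a1 xB; rewrite -[z]scale1r -a1 scaler_suml -sumrB.
rewrite (le_trans (enorm_sum _ _ _))// -[leRHS]mul1r -a1 mulr_suml.
by apply: ler_sum => i _; rewrite -scalerBr enormZ ger0_norm// ler_wpM2l.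
Qed.

(** The zero vector [u i0] takes up weight at least [c], leaving at most [1 - c] for the other
    terms; this is the source of the contraction factor. *)
Lemma enorm_convex_le_skip {I : finType} (a : I -> R) (u : I -> 'rV[R]_m)
    (B c : R) (i0 : I) :
  (forall i, 0 <= a i) -> \sum_i a i = 1 -> 0 <= B -> c <= a i0 -> u i0 = 0 ->
  (forall i, enorm (u i) <= B) -> enorm (\sum_i a i *: u i) <= (1 - c) * B.
Proof.
move=> a0 a1 B0 ac ui0 uB; rewrite (bigD1 i0)//= ui0 scaler0 add0r.
rewrite (le_trans (enorm_sum _ _ _))//.
apply: (@le_trans _ _ (\sum_(i | i != i0) a i * B)).
  by apply: ler_sum => i _; rewrite enormZ ger0_norm// ler_wpM2l.
by rewrite -mulr_suml ler_wpM2r//; move: a1; rewrite (bigD1 i0)//=; lra.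
Qed.

(** * Topology and compactness in terms of the Euclidean norm *)

Lemma near_enorm x (e : R) : 0 < e -> \forall y \near x, enorm (x - y) < e.
Proof.
move=> e0; apply/nbhs_normP; exists (e / m.+1%:R) => /=; first exact: divr_gt0.
move=> y /=; rewrite ltr_pdivlMr// mulrC -natr1 mulrDl mul1r => xy.
have := enorm_le_norm (x - y); have := normr_ge0 (x - y); lra.
Qed.

(** Required for all ordered pairs, the bound is two-sided, so [h] is continuous on [X]. It serves
    for projections, the diameter and the minimizer of the objective. *)
Lemma lipschitz_argmin (h : 'rV[R]_m -> R) (K : R) (X : set 'rV[R]_m) :
  0 < K -> compact X -> X !=set0 ->
  (forall x y, X x -> X y -> h x - h y <= K * enorm (x - y)) ->
  exists z, X z /\ forall y, X y -> h z <= h y.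
Proof.
move=> K0 cX X0 hK.
have hc : {within X, continuous h}.
  apply/subspace_continuousP => x Xx.
  apply/(@cvgrPdist_lt _ _ _ _ (within_filter _ (nbhs_filter x))) => e e0.
  have /near_enorm xe : 0 < e / K by exact: divr_gt0.
  apply: filterS (xe x) => y; rewrite ltr_pdivlMr// mulrC => xy Xy.
  have := hK _ _ Xx Xy; have := hK _ _ Xy Xx.
  by rewrite (enormB y) ltr_norml /from_subspace; lra.
have [z Xz hz] := compact_EVT_min X0 cX hc.
by exists z; split=> [|y Xy]; [rewrite inE in Xz|apply: hz; rewrite inE].
Qed.

Lemma compact_cluster_seq (X : set 'rV[R]_m) (y : nat -> 'rV[R]_m) :
  compact X -> (forall j, X (y j)) ->
  exists2 z, X z & forall e N, 0 < e -> exists2 j, (N <= j)%N & enorm (z - y j) < e.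
Proof.
move=> cX Xy.
have [|z [Xz clz]] := cX (y @ \oo); first by exists 0 => // j _; exact: Xy.
exists z => // e N e0.
have yN : (y @ \oo) [set y j | j in [set j | (N <= j)%N]].
  by exists N => // j Nj /=; exists j.
by have [_ [[j Nj <-] zj]] := clz _ _ yN (near_enorm z e0); exists j.
Qed.

(** * Convexity, projection and diameter *)

Lemma convex_setP (X : set 'rV[R]_m) : convex_set X ->
  forall x y (t : R), X x -> X y -> 0 <= t <= 1 -> X (t *: x + (1 - t) *: y).
Proof.
move=> cX x y t Xx Xy t01.
have := cX x y (Itv01 (andP t01).1 (andP t01).2).
by rewrite !inE; apply.
Qed.

Lemma convex_functionP (U : set 'rV[R]_m) (f : 'rV[R]_m -> R) :
  convex_function U f ->
  forall x y (t : R), U x -> U y -> 0 <= t <= 1 ->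
    f (t *: x + (1 - t) *: y) <= t * f x + (1 - t) * f y.
Proof.
move=> cf x y t Ux Uy t01.
have := cf (Itv01 (andP t01).1 (andP t01).2) x y.
by rewrite !inE; apply.
Qed.

Lemma convex_set_sum {I : finType} (X : set 'rV[R]_m) (a : I -> R)
    (x : I -> 'rV[R]_m) :
  convex_set X -> (forall i, 0 <= a i) -> \sum_i a i = 1 ->
  (forall i, X (x i)) -> X (\sum_i a i *: x i).
Proof.
move=> /convex_setP cX a0 a1 Xx.
(* Partial sums are normalised so that each is a genuine convex combination and the binary case
   applies. *)
suff H (r : seq I) : 0 < \sum_(i <- r) a i ->
    X ((\sum_(i <- r) a i)^-1 *: \sum_(i <- r) a i *: x i).
  by have := H (index_enum I); rewrite a1 invr1 scale1r; apply.
elim: r => [|i r IH]; first by rewrite big_nil ltxx.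
rewrite !big_cons; set s := \sum_(j <- r) a j => s0.
have : 0 <= s by apply: sumr_ge0.
rewrite le_eqVlt => /orP[/eqP s0'|sgt0].
  have r0 : \sum_(j <- r) a j *: x j = 0.
    have /eqP := s0'; rewrite eq_sym psumr_eq0// => /allP r0.
    by rewrite big_seq big1// => j /r0/eqP ->; rewrite scale0r.
  rewrite r0 -s0' !addr0 scalerA mulVf ?scale1r//.
  by rewrite -s0' addr0 in s0; rewrite gt_eqF.
have -> : (a i + s)^-1 *: (a i *: x i + \sum_(j <- r) a j *: x j) =
    (a i / (a i + s)) *: x i + (1 - a i / (a i + s)) *:
      (s^-1 *: \sum_(j <- r) a j *: x j).
  rewrite scalerDr !scalerA; congr (_ *: _ + _ *: _); first by rewrite mulrC.
  by field; rewrite !gt_eqF.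
apply: cX => //; first exact: IH.
by rewrite divr_ge0 ?(ltW s0)//= ler_pdivrMr// mul1r lerDl ltW.
Qed.

(** The default value of [xget] is excluded by the existence of a nearest point. *)
Lemma projP (X : set 'rV[R]_m) x : compact X -> X !=set0 ->
  X (proj X x) /\ forall q, X q -> enorm (x - proj X x) <= enorm (x - q).
Proof.
move=> cX X0; rewrite /proj; case: xgetP => [y _ //|].
have [|z [Xz zmin] /(_ z) []//] :=
  lipschitz_argmin (h := fun q => enorm (x - q)) ltr01 cX X0.
move=> y z _ _; rewrite mul1r enormB (enormB x z).
by have := enorm_triangle z y x; lra.
Qed.

Lemma compact_diameter (X : set 'rV[R]_m) : compact X -> X !=set0 ->
  exists2 Delta, 0 <= Delta & forall x y, X x -> X y -> enorm (x - y) <= Delta.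
Proof.
move=> cX X0; have [z Xz] := X0.
have [|w [Xw wmax]] := lipschitz_argmin (h := fun q => - enorm (q - z)) ltr01 cX X0.
  move=> x y _ _; rewrite mul1r (enormB x y).
  by have := enorm_triangle x y z; lra.
exists (2 * enorm (w - z)) => [|x y Xx Xy]; first by rewrite mulr_ge0 ?enorm_ge0.
have := enorm_triangle z x y; have := wmax _ Xx; have := wmax _ Xy.
by rewrite (enormB z y); lra.
Qed.

(* Compare [proj X x] with the points [t z + (1 - t) proj X x] and let [t -> 0]. *)
Lemma enorm_proj_le (X : set 'rV[R]_m) x z : compact X -> convex_set X -> X z ->
  enorm (proj X x - z) <= enorm (x - z).
Proof.
move=> cX /convex_setP hX Xz; set q := proj X x.
have [Xq qmin] := projP x cX (ex_intro _ z Xz); rewrite -/q in Xq qmin.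
pose u := x - q; pose w := z - q.
(* The angle between [x - q] and [z - q] is not acute; expanding squares then gives the claim. *)
suff uw : dotv u w <= 0.
  rewrite -ler_sqr ?nnegrE ?enorm_ge0//.
  have -> : x - z = u - w by rewrite /u /w opprB subrKA.
  have -> : q - z = - w by rewrite opprB.
  clearbody u w; rewrite !sqr_enorm !dotvE (dotvC w u); have := dotv_ge0 u; lra.
have tP t : 0 < t <= 1 -> 2 * dotv u w <= t * dotv w w.
  move=> /andP[t0 t1].
  have := qmin _ (hX _ _ t Xz Xq _); rewrite ltW//= => /(_ t1).
  have -> : x - (t *: z + (1 - t) *: q) = u - t *: w.
    rewrite /u /w; apply/rowP => c; rewrite !mxE; ring.
  rewrite -ler_sqr ?nnegrE ?enorm_ge0// -/u; clearbody u w.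
  rewrite !sqr_enorm !dotvE (dotvC w u) => h.
  by rewrite -(ler_pM2l t0); lra.
rewrite leNgt; apply/negP => uw0.
have ww0 := dotv_ge0 w.
have s0 : 0 < dotv u w + dotv w w by lra.
(* For this [t], which lies in the admissible range, [t * dotv w w < dotv u w], against [tP]. *)
have := tP (dotv u w / (dotv u w + dotv w w)).
rewrite divr_gt0//= ler_pdivrMr// mul1r lerDl ww0 => /(_ isT).
by rewrite mulrAC ler_pdivlMr//; nra.
Qed.

End EuclideanNorm.

(** * Existence of subgradients and the Lipschitz bound *)

Section Subgradient.
Context {R : realType} {m : nat}.
Implicit Types (x y w g : 'rV[R]_m) (U : set 'rV[R]_m) (f : 'rV[R]_m -> R).

Lemma norm_le_enorm x : `|x| <= enorm x.
Proof.
rewrite [leLHS]mx_normrE bigmax_le ?enorm_ge0// => -[i j] _ /=.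
by rewrite ord1 coord_le_enorm.
Qed.

Lemma open_enorm_ball U x : open U -> U x ->
  exists2 r, 0 < r & forall y, enorm (x - y) < r -> U y.
Proof.
move=> oU Ux; have /nbhs_normP[r /= r0 rU] := open_nbhs_nbhs (conj oU Ux).
by exists r => // y xy; apply: rU => /=; rewrite (le_lt_trans (norm_le_enorm _)).
Qed.

(* Finite-dimensional Hahn-Banach: the functional [dotv _ g] is extended to one
   more coordinate at a time, the slope along the new coordinate being the
   supremum of the lower bounds imposed by convexity. *)
Lemma subgradient_exists U f x : open U -> convex_set U -> convex_function U f ->
  U x -> exists g, subdifferential U f x g.
Proof.
move=> oU /convex_setP cU /convex_functionP cf Ux.
(* The induction enlarges the subspace [W k] from zero at [k = 0] to the whole space at [k = m]. *)
pose W k w := forall c : 'I_m, (k <= c)%N -> w 0 c = 0.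
suff H k : (k <= m)%N -> exists g, forall w, W k w -> U (x + w) ->
    f x + dotv w g <= f (x + w).
  have [g gP] := H m (leqnn m); exists g => y Uy.
  have := gP (y - x); rewrite (addrC x) subrK => /(_ _ Uy); rewrite lerBrDl; apply.
  by move=> c; rewrite leqNgt ltn_ord.
elim: k => [_|k IH km].
  exists 0 => w Ww _; have -> : w = 0 by apply/rowP => c; rewrite mxE Ww.
  by rewrite dot0v !addr0.
have [g gP] := IH (ltnW km).
pose c0 := Ordinal km; pose e : 'rV[R]_m := delta_mx 0 c0.
pose low (s : R) w := (f x + dotv w g - f (x + (w - s *: e))) / s.
pose S := [set l | exists s w,
  [/\ 0 < s, W k w, U (x + (w - s *: e)) & l = low s w]].
have lowP (t s : R) w w' : 0 < t -> 0 < s -> W k w -> W k w' ->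
    U (x + (w + t *: e)) -> U (x + (w' - s *: e)) ->
    low s w' <= (f (x + (w + t *: e)) - f x - dotv w g) / t.
  move=> t0 s0 Ww Ww' Ua Ub; have st0 : 0 < s + t by exact: addr_gt0.
  (* This weight cancels the [e] components, so the combination of the two displacements lies in
     [W k], where the inductive bound holds. *)
  pose l := s / (s + t).
  have l01 : 0 <= l <= 1.
    by rewrite divr_ge0 ?(ltW s0) ?(ltW st0)//= ler_pdivrMr// mul1r lerDl ltW.
  have := cf _ _ _ Ua Ub l01.
  have cE : l *: (x + (w + t *: e)) + (1 - l) *: (x + (w' - s *: e)) =
      x + (l *: w + (1 - l) *: w').
    by apply/rowP => c; rewrite !mxE /l; field; rewrite gt_eqF.
  have := gP (l *: w + (1 - l) *: w'); rewrite -cE => /(_ _ (cU _ _ _ Ua Ub l01)).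
  have Wl : W k (l *: w + (1 - l) *: w').
    by move=> c kc; rewrite !mxE Ww// Ww'// !mulr0 addr0.
  move=> /(_ Wl) /le_trans /[apply]; rewrite !dotvE.
  rewrite /low ler_pdivrMr// [X in _ -> _ <= X]mulrAC ler_pdivlMr//.
  move: (f (x + (w + _))) (f (x + (w' - _))) => fa fb h.
  have : (s + t) * (f x + (l * dotv w g + (1 - l) * dotv w' g)) <=
     (s + t) * (l * fa + (1 - l) * fb) by rewrite ler_pM2l.
  have lE a b : (s + t) * (l * a + (1 - l) * b) = s * a + t * b.
    by rewrite /l; field; rewrite gt_eqF.
  by rewrite mulrDr !lE; lra.
have [r r0 rU] := open_enorm_ball oU Ux.
have W0 : W k 0 by move=> c _; rewrite mxE.
have Ur (t : R) : `|t| < r -> U (x + (0 + t *: e)).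
  move=> tr; apply: rU; rewrite add0r opprD addrA subrr sub0r.
  by rewrite enormN enormZ enorm_delta mulr1.
(* Of the points at distance [r / 2] from [x] along [e], the one on the negative side makes [S]
   nonempty and the other bounds it above. *)
have r2 : 0 < r / 2 by rewrite divr_gt0.
have Sub : has_sup S.
  split.
    exists (low (r / 2) 0), (r / 2), 0; split=> //; rewrite -scaleNr.
    by apply: Ur; rewrite normrN (gtr0_norm r2); lra.
  exists ((f (x + (0 + (r / 2) *: e)) - f x - dotv 0 g) / (r / 2)).
  move=> _ [s [w [s0 Ww Uw ->]]]; apply: lowP => //.
  by apply: Ur; rewrite (gtr0_norm r2); lra.
exists (g + (sup S - g 0 c0) *: e) => w' Ww' Uw'.
pose t := w' 0 c0; pose w := w' - t *: e.
have w'E : w' = w + t *: e by rewrite subrK.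
have Ww : W k w.
  move=> c kc; rewrite !mxE eqxx /= -val_eqE /=.
  have [ck|ck] := eqVneq (c : nat) k.
    by rewrite mulr1 (_ : c = c0) ?subrr//; apply: val_inj.
  by rewrite mulr0 subr0 Ww'// ltn_neqAle eq_sym ck.
have -> : dotv w' (g + (sup S - g 0 c0) *: e) = dotv w g + t * sup S.
  rewrite dotvDr dotvZr dotv_delta -/t [in dotv w' g]w'E dotvDl dotvZl.
  by rewrite (dotvC e) dotv_delta; ring.
(* The supremum lies below every upper quotient, used for [t > 0], and above [low (- t) w], used for
   [t < 0]. *)
have [t0|t0|t0] := ltgtP t 0; last first.
- rewrite w'E t0 scale0r mul0r !addr0 gP//.
  by move: Uw'; rewrite w'E t0 scale0r addr0.
- have : sup S <= (f (x + (w + t *: e)) - f x - dotv w g) / t.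
    apply: ge_sup; first by case: Sub.
    by move=> _ [s [v [s0 Wv Uv ->]]]; apply: lowP; rewrite -?w'E.
  by rewrite ler_pdivlMr// -w'E; lra.
have : low (- t) w <= sup S.
  apply: sup_upper_bound => //; exists (- t), w.
  by rewrite oppr_gt0 scaleNr opprK -w'E.
by rewrite /low scaleNr opprK -w'E ler_pdivrMr ?oppr_gt0//; lra.
Qed.

(** A subgradient at [x] is tested at [y] and bounded through Cauchy-Schwarz. *)
Lemma lipschitz_of_subgradient_bound U f (X : set 'rV[R]_m) (L : R) :
  open U -> convex_set U -> convex_function U f -> X `<=` U ->
  (forall x g, X x -> subdifferential U f x g -> enorm g <= L) ->
  forall x y, X x -> X y -> f x - f y <= L * enorm (x - y).
Proof.
move=> oU cU cf XU gL x y Xx Xy.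
have [g gx] := subgradient_exists oU cU cf (XU _ Xx).
have := gx y (XU _ Xy); have := cauchy_schwarz (x - y) g.
have : enorm (x - y) * enorm g <= L * enorm (x - y).
  by rewrite mulrC ler_wpM2r ?enorm_ge0// (gL x).
by rewrite -(opprB x y) dotvNl; lra.
Qed.
End Subgradient.

(** * Products of stochastic matrices *)

Section Transition.
Context {R : realType} {n : nat}.
Implicit Types (A : nat -> 'M[R]_n) (M N : 'M[R]_n).

(** The state-transition matrix of pure averaging from time [k] to time [k + s]; later factors stand
    on the left. *)
Fixpoint transition A (k s : nat) : 'M[R]_n :=
  if s is s'.+1 then A (k + s')%N *m transition A k s' else 1%:M.

Lemma transitionD A k s s' :
  transition A k (s + s') = transition A (k + s) s' *m transition A k s.
Proof.
by elim: s' => [|s' IH]; rewrite ?addn0 ?mul1mx// addnS /= IH mulmxA addnA.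
Qed.

Lemma transitionSr A k s : transition A k s.+1 = transition A k.+1 s *m A k.
Proof. by rewrite -add1n transitionD /= addn0 mulmx1 addn1. Qed.

Lemma transition_periodic A p k s : (forall k, A (k + p)%N = A k) ->
  transition A (k + p) s = transition A k s.
Proof. by move=> Ap; elim: s => //= s ->; rewrite addnAC Ap. Qed.

Lemma transition_periodic_mul A p q k s : (forall k, A (k + p)%N = A k) ->
  transition A (k + p * q) s = transition A k s.
Proof.
move=> Ap; elim: q => [|q IH]; first by rewrite muln0 addn0.
by rewrite mulnS addnCA addnC transition_periodic.
Qed.

(** * Row-stochastic products and their positivity *)

Lemma row_stochastic1 : row_stochastic (1%:M : 'M[R]_n).
Proof.
split=> i; first by move=> j; rewrite mxE ler0n.
rewrite (bigD1 i)//= mxE eqxx big1 ?addr0// => j /negPf ij.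
by rewrite mxE eq_sym ij.
Qed.

Lemma row_stochastic_mul M N :
  row_stochastic M -> row_stochastic N -> row_stochastic (M *m N).
Proof.
move=> [M0 M1] [N0 N1]; split=> i.
  by move=> j; rewrite mxE sumr_ge0// => l _; rewrite mulr_ge0.
under eq_bigr do rewrite mxE.
rewrite exchange_big /= -[RHS](M1 i); apply: eq_bigr => l _.
by rewrite -mulr_sumr N1 mulr1.
Qed.

Lemma row_stochastic_transition A k s :
  (forall k, row_stochastic (A k)) -> row_stochastic (transition A k s).
Proof.
move=> As; elim: s => [|s IH]; first exact: row_stochastic1.
exact: row_stochastic_mul.
Qed.

Lemma transition_diag_gt0 A k s i :
  (forall k, row_stochastic (A k)) -> (forall k i, 0 < A k i i) ->
  0 < transition A k s i i.
Proof.
move=> As Ad; elim: s => [|s IH] /=; first by rewrite mxE eqxx ltr01.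
rewrite mxE (bigD1 i)//= ltr_wpDr ?mulr_gt0// sumr_ge0// => l _.
by rewrite mulr_ge0// ?(As _).1// (row_stochastic_transition _ _ As).1.
Qed.

Lemma mulmx_entry_gt0 M N i l j :
  row_stochastic M -> row_stochastic N -> 0 < M i l -> 0 < N l j ->
  0 < (M *m N) i j.
Proof.
move=> [M0 _] [N0 _] Mil Nlj; rewrite mxE (bigD1 l)//= ltr_wpDr ?mulr_gt0//.
by apply: sumr_ge0 => l' _; rewrite mulr_ge0.
Qed.

Lemma connect_out (T : finType) (e : rel T) (S : {set T}) x y :
  connect e x y -> x \in S -> y \notin S ->
  exists u v, [/\ u \in S, v \notin S & e u v].
Proof.
move=> /connectP[s + ->].
elim: s x => [x _ /= -> //|z s IH x /= /andP[xz zs] xS yS].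
by have [zS|zS] := boolP (z \in S); [exact: (IH z)|exists x, z].
Qed.

(* Over each window of length [B] the set of nodes reached from [j] grows until
   it is everything. *)
Lemma transition_gt0 A (B : nat) k :
  (forall k, row_stochastic (A k)) -> (forall k i, 0 < A k i i) ->
  (forall k, strongly_connected
     (fun j i => [exists s : 'I_B, edge (A (k + s)%N) j i])) ->
  forall i j, 0 < transition A k (n * B) i j.
Proof.
move=> As Ad sc i j.
have Ts k' s := row_stochastic_transition k' s As.
pose S t := [set i | 0 < transition A k (t * B) i j]%SET.
have Sj t : j \in S t by rewrite inE transition_diag_gt0.
have Smono t : S t \subset S t.+1.
  apply/fintype.subsetP => l; rewrite !inE mulSnr transitionD => lS.
  by apply: (mulmx_entry_gt0 (l := l)) => //; exact: transition_diag_gt0.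
have Sgrow t : S t != [set: 'I_n]%SET -> (#|S t| < #|S t.+1|)%N.
  rewrite -finset.subTset => /fintype.subsetPn[y _ yS].
  have [u [v [uS vS /existsP[s uv]]]] :=
    connect_out (sc (k + t * B)%N j y) (Sj t) yS.
  apply: proper_card; rewrite properE Smono; apply/fintype.subsetPn; exists v => //.
  rewrite !inE in uS *; rewrite mulSnr transitionD.
  (* The window is cut around the time [s] of the crossing edge: self-loops hold [u] before it and
     [v] after it. *)
  have -> : transition A (k + t * B) B =
      transition A (k + t * B) (s + (1 + (B - s.+1))).
    by congr transition; have := ltn_ord s; lia.
  apply: (mulmx_entry_gt0 (l := u)) => //.
  rewrite transitionD; apply: (mulmx_entry_gt0 (l := u)) => //; last first.
    exact: transition_diag_gt0.
  rewrite transitionD; apply: (mulmx_entry_gt0 (l := v)) => //.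
    exact: transition_diag_gt0.
  by rewrite /= addn0 mulmx1.
(* Strict growth adds at least one node per window, so [n] windows suffice. *)
have Scard t : (t < #|S t|)%N || (S t == [set: 'I_n]%SET).
  elim: t => [|t /orP[IH|/eqP St]].
  - by rewrite card_gt0; apply/orP; left; apply/finset.set0Pn; exists j.
  - have [St|St] := eqVneq (S t) [set: 'I_n]%SET.
      by rewrite orbC -finset.subTset -St Smono.
    by rewrite (leq_ltn_trans IH)// Sgrow.
  - by rewrite orbC -finset.subTset -St Smono.
have := Scard n; rewrite ltnNge -[X in (_ <= X)%N]card_ord max_card /=.
move=> /eqP Sn; have : i \in S n by rewrite Sn finset.in_setT.
by rewrite inE.
Qed.

(* If the positive part [S] of a fixed row [d] of zero sum were nonempty, it would
   not be everything, and [M] would move some of its mass out of [S]. *)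
Lemma fixed_row_le0 M (d : 'rV[R]_n) :
  row_stochastic M -> (forall i j, 0 < M i j) ->
  \sum_i d 0 i = 0 -> d *m M = d -> forall j, d 0 j <= 0.
Proof.
move=> [_ M1] Mgt0 d0 dM j0; rewrite leNgt; apply/negP => j0S.
pose mass i := \sum_(j | 0 < d 0 j) M i j.
have [i0 i0S] : exists i0, d 0 i0 <= 0.
  apply/not_existsP => S; suff : 0 < \sum_i d 0 i by rewrite d0 ltxx.
  have dgt0 i : 0 < d 0 i by rewrite ltNge; apply/negP/S.
  by rewrite (bigD1 j0)//= ltr_pwDl// sumr_ge0// => i _; rewrite ltW.
have mass_lt1 i : mass i < 1.
  rewrite -(M1 i) (bigID (fun j => 0 < d 0 j))/= ltrDl (bigD1 i0)/= -?leNgt//.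
  by rewrite ltr_pwDl// sumr_ge0// => j _; rewrite ltW.
have mass_ge0 i : 0 <= mass i by apply: sumr_ge0 => j _; rewrite ltW.
(* As [d] is fixed by [M], the left side is the sum of [d 0 i * mass i] over all [i]; dropping the
   indices with nonpositive [d 0 i] can only increase it. *)
have : \sum_(j | 0 < d 0 j) d 0 j <= \sum_(i | 0 < d 0 i) d 0 i * mass i.
  have -> : \sum_(j | 0 < d 0 j) d 0 j = \sum_i d 0 i * mass i.
    under [RHS]eq_bigr do rewrite mulr_sumr.
    rewrite exchange_big /=; apply: eq_bigr => j _.
    by rewrite -[in LHS]dM mxE.
  rewrite (bigID (fun i => 0 < d 0 i))/= gerDl sumr_le0// => i.
  by rewrite -leNgt => di; rewrite mulr_le0_ge0.
rewrite leNgt => /negP; apply; apply: ltr_sum => [|i di].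
  by apply/hasP; exists j0; rewrite ?mem_index_enum.
by rewrite gtr_pMr.
Qed.

Lemma fixed_row_unique M (a b : 'rV[R]_n) :
  row_stochastic M -> (forall i j, 0 < M i j) ->
  \sum_i a 0 i = \sum_i b 0 i -> a *m M = a -> b *m M = b -> a = b.
Proof.
move=> Ms M0 ab aM bM; apply/rowP => i; apply/eqP.
rewrite eq_le -subr_le0 -[X in _ && X]subr_le0.
have := @fixed_row_le0 M (a - b) Ms M0; have := @fixed_row_le0 M (b - a) Ms M0.
rewrite !mulmxBl aM bM.
have -> : \sum_i (a - b) 0 i = 0.
  by under eq_bigr do rewrite !mxE; rewrite sumrB ab subrr.
have -> : \sum_i (b - a) 0 i = 0.
  by under eq_bigr do rewrite !mxE; rewrite sumrB ab subrr.
by move=> /(_ erefl erefl i) + /(_ erefl erefl i); rewrite !mxE => -> ->.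
Qed.

Lemma fixed_row_transition A p k q (a : 'rV[R]_n) : (forall k, A (k + p)%N = A k) ->
  a *m transition A k p = a -> a *m transition A k (p * q) = a.
Proof.
move=> Ap ak; elim: q => [|q IH]; first by rewrite muln0 mulmx1.
by rewrite mulnS addnC transitionD mulmxA transition_periodic_mul// ak.
Qed.

(** By periodicity [b *m A k] is fixed by the product over the period from [k], as is [a].
    Uniqueness is applied to the [q]-th power of that product, which is positive. *)
Lemma perron_step A p q k (a b : 'rV[R]_n) :
  (forall k, A (k + p)%N = A k) -> (forall k, row_stochastic (A k)) ->
  (forall i j, 0 < transition A k (p * q) i j) ->
  \sum_i a 0 i = 1 -> \sum_i b 0 i = 1 ->
  a *m transition A k p = a -> b *m transition A k.+1 p = b ->
  b *m A k = a.
Proof.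
move=> Ap As Tgt0 a1 b1 ak bk.
apply: (fixed_row_unique (row_stochastic_transition k (p * q) As)) => //.
- rewrite a1 -b1; under eq_bigr do rewrite mxE.
  rewrite exchange_big /=; apply: eq_bigr => i _.
  by rewrite -mulr_sumr (As k).2 mulr1.
- apply: fixed_row_transition => //.
  rewrite -mulmxA -[A k in LHS](Ap k) -[X in b *m X]/(transition A k p.+1).
  by rewrite transitionSr mulmxA bk.
- exact: fixed_row_transition.
Qed.

(** The matrices [Ap] are numbered from 1 and times from 0, whence the successor. *)
Lemma desc_prod_transition A (Ap : nat -> 'M[R]_n) k s :
  (forall j, (j < s)%N -> A (k + j)%N = Ap (k + j).+1) ->
  desc_prod Ap k.+1 (k + s) = transition A k s.
Proof.
elim: s => [|s IH] AAp.
  by rewrite /desc_prod /index_iota addn0 subnn big_nil.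
rewrite /desc_prod /index_iota subSS addKn.
have -> : iota k.+1 s.+1 = rcons (iota k.+1 s) (k + s).+1.
  by rewrite -[s.+1]addn1 iotaD cats1 addSn.
rewrite rev_rcons big_cons /=.
rewrite -IH => [|j js]; last by apply: AAp; rewrite ltnS ltnW.
by rewrite /= AAp// /desc_prod /index_iota subSS addKn.
Qed.

End Transition.

(** * Real sequences *)

Section RealSequences.
Context {R : realType}.
Implicit Types (a b D V e g : nat -> R).

(** The partial sum up to [T] is within [eps] of the supremum, which leaves less than [eps] for any
    later stretch. *)
Lemma sum_tail_small e C : (forall t, 0 <= e t) ->
  (forall N, \sum_(0 <= t < N) e t <= C) ->
  forall eps, 0 < eps ->
    exists T, forall t N, (T <= t)%N -> \sum_(t <= s < N) e s < eps.
Proof.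
move=> e0 eC eps eps0.
pose S := [set \sum_(0 <= t < N) e t | N in [set: nat]].
have supS : has_sup S.
  split; first by exists (\sum_(0 <= t < 0) e t), 0%N.
  by exists C => _ [N _ <-].
have [_ [T _ <-] supT] := sup_adherent eps0 supS.
exists T => t N Tt; have [Nt|tN] := leqP N t; first by rewrite big_geq.
have := sup_upper_bound supS; move=> /(_ (\sum_(0 <= t < N) e t)) => supN.
have {supN} := supN (ex_intro2 _ _ N I erefl).
rewrite (big_cat_nat (leq0n t) (ltnW tN)) (big_cat_nat (leq0n T) Tt)/=.
have : 0 <= \sum_(T <= i < t) e i by apply: sumr_ge0.
by lra.
Qed.

Lemma sum_sqr_small D C : (forall t, 0 <= D t) ->
  (forall N, \sum_(0 <= t < N) D t ^+ 2 <= C) ->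
  forall eps, 0 < eps -> exists T, forall t, (T <= t)%N -> D t < eps.
Proof.
move=> D0 DC eps eps0.
have [t|T TP] := sum_tail_small _ DC (exprn_gt0 2 eps0); first exact: sqr_ge0.
exists T => t /(TP t t.+1); rewrite big_nat1 ltr_sqr// nnegrE ?D0//.
exact: ltW.
Qed.

(* By convexity of the square,
   [(rho D + K a) ^ 2 <= rho D ^ 2 + K ^ 2 a ^ 2 / (1 - rho)]. *)
Lemma contraction_sum_sqr D a (rho K C : R) : 0 <= rho < 1 -> 0 <= K ->
  (forall t, 0 <= D t) -> (forall t, 0 <= a t) ->
  (forall t, D t.+1 <= rho * D t + K * a t) ->
  (forall N, \sum_(0 <= t < N) a t ^+ 2 <= C) ->
  exists C', forall N, \sum_(0 <= t < N) D t ^+ 2 <= C'.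
Proof.
move=> /andP[rho0 rho1] K0 D0 a0 Drec aC.
have r0 : 0 < 1 - rho by lra.
exists ((D 0%N ^+ 2 + K ^+ 2 / (1 - rho) * C) / (1 - rho)) => N.
have step t : D t.+1 ^+ 2 <= rho * D t ^+ 2 + K ^+ 2 / (1 - rho) * a t ^+ 2.
  apply: (@le_trans _ _ ((rho * D t + K * a t) ^+ 2)).
    by rewrite ler_sqr ?nnegrE ?addr_ge0 ?mulr_ge0.
  rewrite -subr_ge0.
  have -> : rho * D t ^+ 2 + K ^+ 2 / (1 - rho) * a t ^+ 2 -
     (rho * D t + K * a t) ^+ 2 =
     rho * ((1 - rho) * D t - K * a t) ^+ 2 / (1 - rho).
    by field; rewrite gt_eqF.
  by rewrite divr_ge0 ?(ltW r0)// mulr_ge0// sqr_ge0.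
(* Summing [step] puts [rho] times the same sum on the right; absorbing it on the left costs the
   factor [1 / (1 - rho)]. *)
have : \sum_(0 <= t < N.+1) D t ^+ 2 <=
    D 0%N ^+ 2 + (rho * \sum_(0 <= t < N) D t ^+ 2 + K ^+ 2 / (1 - rho) * C).
  rewrite big_nat_recl//= lerD2l.
  apply: (@le_trans _ _ (\sum_(0 <= t < N)
    (rho * D t ^+ 2 + K ^+ 2 / (1 - rho) * a t ^+ 2))).
    by apply: ler_sum => t _.
  rewrite big_split -!mulr_sumr lerD2l ler_wpM2l//.
  by rewrite divr_ge0 ?sqr_ge0 ?ltW.
rewrite big_nat_recr//= ler_pdivlMr//.
by have := sqr_ge0 (D N); lra.
Qed.

Lemma descent_sum V b e : (forall t, V t.+1 <= V t - b t + e t) ->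
  forall t N, (t <= N)%N ->
    V N + \sum_(t <= s < N) b s <= V t + \sum_(t <= s < N) e s.
Proof.
move=> Vrec t; elim=> [|N IH]; first by rewrite leqn0 => /eqP ->; rewrite !big_geq.
rewrite leq_eqVlt => /orP[/eqP ->|]; first by rewrite !big_geq.
rewrite ltnS => tN; rewrite !big_nat_recr//=.
by have := IH tN; have := Vrec N; lra.
Qed.

(** If [g] stayed at least [eps] from [T] on, telescoping would bound [eps] times the tail sums of
    [b], against their divergence. *)
Lemma descent_gap_small V b e g C : (forall t, 0 <= V t) ->
  (forall t, 0 <= b t) -> (forall M, exists N, M < \sum_(0 <= t < N) b t) ->
  (forall t, V t.+1 <= V t - b t * g t + e t) ->
  (forall t, 0 <= e t) -> (forall N, \sum_(0 <= t < N) e t <= C) ->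
  forall eps T, 0 < eps -> exists2 t, (T <= t)%N & g t < eps.
Proof.
move=> V0 b0 binf Vrec e0 eC eps T eps0; apply: contrapT => gT.
have gbig t : (T <= t)%N -> eps <= g t.
  by move=> Tt; rewrite leNgt; apply/negP => gt; apply: gT; exists t.
have [N] := binf (\sum_(0 <= t < T) b t + (V T + C) / eps).
apply/negP; rewrite -leNgt.
have [NT|TN] := leqP N T.
  rewrite (big_cat_nat (leq0n N) NT)/= -addrA lerDl addr_ge0 ?sumr_ge0//.
  rewrite divr_ge0 ?(ltW eps0)// addr_ge0//.
  by have := eC 0%N; rewrite big_geq.
rewrite (big_cat_nat (leq0n T) (ltnW TN))/= lerD2l ler_pdivlMr// mulr_suml.
apply: (@le_trans _ _ (\sum_(T <= i < N) b i * g i)).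
  rewrite big_nat [leRHS]big_nat; apply: ler_sum => t /andP[Tt _].
  by rewrite ler_wpM2l// gbig.
have := descent_sum Vrec (ltnW TN); have := V0 N; have := eC N.
rewrite (big_cat_nat (leq0n T) (ltnW TN))/=.
have : 0 <= \sum_(0 <= i < T) e i by apply: sumr_ge0.
by lra.
Qed.

(** * Series, shifts and block sums *)

Lemma eseries_pinfty_unbounded a (a0 : forall k, 0 <= a k) :
  (\sum_(0 <= k <oo) (a k)%:E = +oo)%E ->
  forall M, exists N, M < \sum_(0 <= k < N) a k.
Proof.
move=> aoo M; apply/not_existsP => H.
have : (\sum_(0 <= k <oo) (a k)%:E <= M%:E)%E.
  apply: lime_le; first by apply: is_cvg_nneseries => k _ _; rewrite lee_fin.
  by apply: nearW => N; rewrite sumEFin lee_fin leNgt; apply/negP/H.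
by rewrite aoo leye_eq.
Qed.

Lemma eseries_fin_bounded a (a0 : forall k, 0 <= a k) :
  (\sum_(0 <= k <oo) (a k)%:E < +oo)%E ->
  exists C, forall N, \sum_(0 <= k < N) a k <= C.
Proof.
move=> aoo; exists (fine (\sum_(0 <= k <oo) (a k)%:E)%E) => N.
rewrite -lee_fin fineK; last first.
  by rewrite ge0_fin_numE//; apply: nneseries_ge0 => k _ _; rewrite lee_fin.
rewrite -sumEFin; apply: nneseries_lim_ge => k _; by rewrite lee_fin.
Qed.

Lemma sum_shift a T N :
  \sum_(0 <= k < N) a (k + T)%N = \sum_(T <= k < N + T) a k.
Proof. by rewrite -[T in RHS]add0n big_addn addnK. Qed.

Lemma unbounded_sum_shift a T :
  (forall M, exists N, M < \sum_(0 <= k < N) a k) -> (forall k, 0 <= a k) ->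
  forall M, exists N, M < \sum_(0 <= k < N) a (k + T)%N.
Proof.
move=> ainf a0 M; have [N NM] := ainf (M + \sum_(0 <= k < T) a k).
exists N; rewrite sum_shift.
have : \sum_(0 <= k < N) a k <= \sum_(0 <= k < N + T) a k.
  by rewrite (big_cat_nat (leq0n N) (leq_addr T N))/= lerDl sumr_ge0.
rewrite (big_cat_nat (leq0n T) (leq_addl N T))/=; lra.
Qed.

(** Starting the minimum at 1 keeps [c <= 1], so that [1 - c ^+ 2] is a contraction factor in
    [spread_rec]. *)
Lemma finite_lower_bound (I : finType) (F : I -> R) : (forall i, 0 < F i) ->
  exists2 c, 0 < c <= 1 & forall i, c <= F i.
Proof.
move=> F0; exists (\big[Num.min/1]_i F i) => [|i]; last exact: bigmin_le_cond.
rewrite bigmin_le_id andbT; apply/bigmin_gtP.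
by split=> [|i _]; [exact: ltr01|exact: F0].
Qed.

Lemma sum_blocks a T N :
  \sum_(0 <= k < N * T) a k = \sum_(0 <= t < N) \sum_(0 <= s < T) a (t * T + s)%N.
Proof.
elim: N => [|N IH]; first by rewrite mul0n !big_geq.
rewrite mulSnr (big_cat_nat (leq0n (N * T)) (leq_addr T _))/= IH big_nat_recr//=.
congr (_ + _); rewrite -[X in index_iota X _]add0n big_addn addKn.
by apply: eq_bigr => s _; rewrite addnC.
Qed.

(** By monotonicity each block of [T] terms sums to at most [T] times its first term. *)
Lemma block_sum_unbounded a T : (0 < T)%N ->
  (forall k, 0 <= a k) -> (forall k l, (k <= l)%N -> a l <= a k) ->
  (forall M, exists N, M < \sum_(0 <= k < N) a k) ->
  forall M, exists N, M < \sum_(0 <= t < N) a (t * T)%N.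
Proof.
move=> T0 a0 amono ainf M; have [N NM] := ainf (M * T%:R); exists N.
have TR : 0 < T%:R :> R by rewrite ltr0n.
rewrite -(ltr_pM2r TR) (lt_le_trans NM)// mulr_suml.
apply: (@le_trans _ _ (\sum_(0 <= k < N * T) a k)).
  have NT : (N <= N * T)%N by rewrite leq_pmulr.
  by rewrite (big_cat_nat (leq0n N) NT)/= lerDl sumr_ge0.
rewrite sum_blocks; apply: ler_sum => t _.
apply: (@le_trans _ _ (\sum_(0 <= s < T) a (t * T)%N)).
  by apply: ler_sum => s _; apply: amono; rewrite leq_addr.
by rewrite sumr_const_nat subn0 mulr_natr.
Qed.

Lemma block_sum_bounded a T C : (0 < T)%N -> (forall k, 0 <= a k) ->
  (forall N, \sum_(0 <= k < N) a k <= C) ->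
  forall N, \sum_(0 <= t < N) a (t * T)%N <= C.
Proof.
move=> T0 a0 aC N; apply: (le_trans _ (aC (N * T)%N)); rewrite sum_blocks.
apply: ler_sum => t _; rewrite big_ltn// addn0 lerDl.
by apply: sumr_ge0.
Qed.

End RealSequences.

(** * Convergence of periodic runs *)

Section PeriodicRun.
Context {R : realType} {m n : nat}.
Variables (X : set 'rV[R]_m) (f : 'I_n -> 'rV[R]_m -> R) (L : R).
Variables (alpha : nat -> R) (A : nat -> 'M[R]_n) (T : nat).
Variables (pi : nat -> 'rV[R]_n) (F : 'rV[R]_m -> R).
Variables (x v d : nat -> 'I_n -> 'rV[R]_m) (i0 : 'I_n).
Hypotheses (cX : compact X) (convX : convex_set X) (L_gt0 : 0 < L).
Hypothesis f_lip : forall i y z, X y -> X z -> f i y - f i z <= L * enorm (y - z).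
Hypotheses (alpha_ge0 : forall k, 0 <= alpha k).
Hypothesis alpha_noninc : forall k l, (k <= l)%N -> alpha l <= alpha k.
Hypothesis alpha_sum : forall M, exists N, M < \sum_(0 <= k < N) alpha k.
Hypothesis alpha_sum2 : exists C, forall N, \sum_(0 <= k < N) alpha k ^+ 2 <= C.
Hypotheses (T_gt0 : (0 < T)%N) (A_per : forall k, A (k + T)%N = A k).
Hypothesis A_stoch : forall k, row_stochastic (A k).
Hypothesis A_pos : forall i j, 0 < transition A 0 T i j.
Hypotheses (pi_ge0 : forall k i, 0 <= pi k 0 i) (pi0_gt0 : forall i, 0 < pi 0 0 i).
Hypotheses (pi_sum : forall k, \sum_i pi k 0 i = 1).
Hypothesis pi_per : forall k, pi (k + T)%N = pi k.
Hypothesis pi_A : forall k, pi k.+1 *m A k = pi k.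
Hypothesis F_avg : forall y,
  \sum_(0 <= s < T) \sum_i pi s.+1 0 i * f i y = T%:R * F y.
Hypothesis Xx : forall k i, X (x k i).
Hypothesis vE : forall k i, v k i = \sum_j A k i j *: x k j.
Hypothesis xE : forall k i, x k.+1 i = proj X (v k i - alpha k *: d k i).
Hypothesis d_sub : forall k i z, X z ->
  dotv (z - v k i) (d k i) <= f i z - f i (v k i).
Hypothesis d_le : forall k i, enorm (d k i) <= L.

Let X0 : X !=set0 := ex_intro _ _ (Xx 0 i0).

Lemma run_mixed_in k i : X (v k i).
Proof. by rewrite vE; apply: convex_set_sum => //; have [] := A_stoch k. Qed.

(** Since [v k i] lies in [X], it is no closer to [w] than the projection is; both legs through [w]
    have length at most [L * alpha k]. *)
Lemma run_step k i : enorm (x k.+1 i - v k i) <= 2 * L * alpha k.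
Proof.
have ad : enorm (alpha k *: d k i) <= L * alpha k.
  by rewrite enormZ ger0_norm// mulrC ler_wpM2r.
rewrite xE; set w := v k i - _.
have := (projP w cX X0).2 _ (run_mixed_in k i).
have := enorm_triangle w (proj X w) (v k i).
have -> : w - v k i = - (alpha k *: d k i) by rewrite /w addrAC subrr sub0r.
by rewrite enormN (enormB _ w); lra.
Qed.

(** * Spread of the agents and its contraction over a block *)

Definition spread k : R :=
  \big[Num.max/0]_(ij : 'I_n * 'I_n) enorm (x k ij.1 - x k ij.2).

Lemma spread_ge0 k : 0 <= spread k.
Proof. exact: bigmax_ge_id. Qed.

Lemma enorm_le_spread k i j : enorm (x k i - x k j) <= spread k.
Proof. exact: (le_bigmax _ (fun ij => enorm (x k ij.1 - x k ij.2)) (i, j)). Qed.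

(** Averaging preserves a bound on the distance to [x k j], and each projected step adds at most
    [2 * L * alpha k], later stepsizes being no larger. *)
Lemma run_drift k s i j :
  enorm (x (k + s) i - x k j) <= spread k + 2 * L * alpha k * s%:R.
Proof.
elim: s i j => [|s IH] i j; first by rewrite addn0 mulr0 addr0 enorm_le_spread.
rewrite addnS (le_trans (enorm_triangle (v (k + s)%N i) _ _))//.
have : enorm (v (k + s) i - x k j) <= spread k + 2 * L * alpha k * s%:R.
  by rewrite vE; apply: enorm_convex_le; have [] := A_stoch (k + s).
have := run_step (k + s) i; rewrite -(natr1 s) mulrDr mulr1.
have : 2 * L * alpha (k + s) <= 2 * L * alpha k.
  by rewrite ler_wpM2l ?mulr_ge0 ?(ltW L_gt0)// alpha_noninc ?leq_addr.
by lra.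
Qed.

(** The run is compared with pure averaging from time [k]; row-stochastic mixing passes earlier
    deviations on without amplifying them. *)
Lemma run_unroll k s i :
  enorm (x (k + s) i - \sum_l transition A k s i l *: x k l) <=
    2 * L * alpha k * s%:R.
Proof.
elim: s i => [|s IH] i.
  rewrite addn0 mulr0 (bigD1 i)//= mxE eqxx scale1r big1 => [|l /negPf li].
    by rewrite addr0 subrr enorm0.
  by rewrite mxE eq_sym li scale0r.
rewrite addnS (le_trans (enorm_triangle (v (k + s)%N i) _ _))//.
have : enorm (v (k + s) i - \sum_l transition A k s.+1 i l *: x k l) <=
    2 * L * alpha k * s%:R.
  have -> : v (k + s) i - \sum_l transition A k s.+1 i l *: x k l =
      \sum_j A (k + s) i j *:
        (x (k + s) j - \sum_l transition A k s j l *: x k l) - 0.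
    rewrite subr0; under [RHS]eq_bigr do rewrite scalerBr scaler_sumr.
    rewrite sumrB -vE exchange_big /=; congr (_ - _); apply: eq_bigr => l _.
    by rewrite mxE scaler_suml; apply: eq_bigr => j _; rewrite scalerA.
  have [a0 a1] := A_stoch (k + s).
  by apply: enorm_convex_le => // j; rewrite subr0.
have := run_step (k + s) i; rewrite -(natr1 s) mulrDr mulr1.
have : 2 * L * alpha (k + s) <= 2 * L * alpha k.
  by rewrite ler_wpM2l ?mulr_ge0 ?(ltW L_gt0)// alpha_noninc ?leq_addr.
by lra.
Qed.

Let M := transition A 0 T.

Lemma transition_block t : transition A (t * T) T = M.
Proof.
by rewrite mulnC -[(T * t)%N]add0n transition_periodic_mul.
Qed.

(* Two rows of [M] average the same points; the pairs [(l, l)] carry weight at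
   least [c ^ 2] and contribute nothing to the difference. *)
Lemma mixing_contracts k i j (c : R) : 0 <= c -> (forall i j, c <= M i j) ->
  enorm (\sum_l M i l *: x k l - \sum_l M j l *: x k l) <= (1 - c ^+ 2) * spread k.
Proof.
move=> c0 cM; have [M0 M1] := row_stochastic_transition 0 T A_stoch.
have -> : \sum_l M i l *: x k l - \sum_l M j l *: x k l =
    \sum_p (M i p.1 * M j p.2) *: (x k p.1 - x k p.2).
  rewrite -(pair_bigA _ (fun l l' => (M i l * M j l') *: (x k l - x k l')))/=.
  under [RHS]eq_bigr do under eq_bigr do rewrite scalerBr.
  under [RHS]eq_bigr do rewrite sumrB.
  rewrite sumrB; congr (_ - _).
    by apply: eq_bigr => l _; rewrite -scaler_suml -mulr_sumr M1 mulr1.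
  rewrite exchange_big/=; apply: eq_bigr => l _.
  by rewrite -scaler_suml -mulr_suml M1 mul1r.
apply: (@enorm_convex_le_skip _ _ _ _ _ _ _ (i0, i0)) => /=.
- by move=> p; rewrite mulr_ge0.
- rewrite -(pair_bigA _ (fun l l' => M i l * M j l'))/=.
  by under eq_bigr do rewrite -mulr_sumr M1 mulr1; exact: M1.
- exact: spread_ge0.
- by rewrite expr2 ler_pM.
- by rewrite subrr.
- by move=> p; exact: enorm_le_spread.
Qed.

Let D t := spread (t * T).
Let a t := alpha (t * T).

(** Replacing each of two agents by its pure average costs [2 * L * T%:R * a t], whence the 4; the
    averages contract by [mixing_contracts]. *)
Lemma spread_rec : exists2 rho, 0 <= rho < 1 &
  forall t, D t.+1 <= rho * D t + 4 * L * T%:R * a t.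
Proof.
have [|c /andP[c0 c1] cM] := @finite_lower_bound R _ (fun ij => M ij.1 ij.2).
  by move=> ij; exact: A_pos.
exists (1 - c ^+ 2) => [|t].
  by rewrite subr_ge0 expr_le1 ?c1 ?(ltW c0)//= ltrBlDr ltrDl exprn_gt0.
rewrite {1}/D {1}/spread; apply: bigmax_le => [|[i j] _ /=].
  rewrite addr_ge0 ?mulr_ge0 ?spread_ge0 ?(ltW L_gt0) ?subr_ge0//.
    by rewrite expr_le1 ?(ltW c0).
  exact: alpha_ge0.
have := mixing_contracts (t * T) i j (ltW c0) (fun i j => cM (i, j)).
have := run_unroll (t * T) T i; have := run_unroll (t * T) T j.
rewrite -mulSnr transition_block.
set xi := x _ i; set xj := x _ j; set mi := \sum_l M i l *: _.
set mj := \sum_l M j l *: _.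
have := enorm_triangle mi xi xj; have := enorm_triangle mj mi xj.
by rewrite (enormB mj xj) /a /D; lra.
Qed.


Lemma block_spread_sum : exists C, forall N, \sum_(0 <= t < N) D t ^+ 2 <= C.
Proof.
have [rho rho01 Drec] := spread_rec; have [C aC] := alpha_sum2.
apply: (@contraction_sum_sqr _ D a rho (4 * L * T%:R) C) => //.
- by rewrite !mulr_ge0 ?ler0n// ltW.
- by move=> t; exact: spread_ge0.
- by move=> t; exact: alpha_ge0.
- by apply: (@block_sum_bounded _ (fun k => alpha k ^+ 2)) => // k; exact: sqr_ge0.
Qed.

(** * Decrease of the weighted squared distance *)

Definition lyapunov z k := \sum_i pi k 0 i * enorm (x k i - z) ^+ 2.

Lemma lyapunov_ge0 z k : 0 <= lyapunov z k.
Proof. by apply: sumr_ge0 => i _; rewrite mulr_ge0 ?sqr_ge0. Qed.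

(** Projection moves no point away from [z]; the square is then expanded and the subgradient
    inequality applied. *)
Lemma lyapunov_step z k : X z ->
  lyapunov z k.+1 <= lyapunov z k
    - 2 * alpha k * (\sum_i pi k.+1 0 i * (f i (v k i) - f i z))
    + alpha k ^+ 2 * L ^+ 2.
Proof.
move=> Xz.
have step i : enorm (x k.+1 i - z) ^+ 2 <=
    \sum_j A k i j * enorm (x k j - z) ^+ 2
    - 2 * alpha k * (f i (v k i) - f i z) + alpha k ^+ 2 * L ^+ 2.
  have [A0 A1] := A_stoch k.
  have := enorm_convex_sum (x k) z (A0 i) (A1 i); rewrite -vE => vz.
  apply: (@le_trans _ _ (enorm (v k i - alpha k *: d k i - z) ^+ 2)).
    by rewrite ler_sqr ?nnegrE ?enorm_ge0// xE enorm_proj_le.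
  have -> : enorm (v k i - alpha k *: d k i - z) ^+ 2 = enorm (v k i - z) ^+ 2
      + 2 * alpha k * dotv (z - v k i) (d k i) + alpha k ^+ 2 * enorm (d k i) ^+ 2.
    by rewrite !sqr_enorm !dotvE !(dotvC _ (v k i)) (dotvC (d k i)); ring.
  have : alpha k * dotv (z - v k i) (d k i) <= alpha k * (f i z - f i (v k i)).
    by rewrite ler_wpM2l// d_sub.
  have : alpha k ^+ 2 * enorm (d k i) ^+ 2 <= alpha k ^+ 2 * L ^+ 2.
    by rewrite ler_wpM2l ?sqr_ge0// ler_sqr ?nnegrE ?enorm_ge0// ltW.
  by lra.
have -> : lyapunov z k - 2 * alpha k * (\sum_i pi k.+1 0 i * (f i (v k i) - f i z))
    + alpha k ^+ 2 * L ^+ 2 = \sum_i pi k.+1 0 i *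
      (\sum_j A k i j * enorm (x k j - z) ^+ 2
       - 2 * alpha k * (f i (v k i) - f i z) + alpha k ^+ 2 * L ^+ 2).
  under [RHS]eq_bigr do rewrite mulrDr mulrBr.
  rewrite big_split sumrB/= -[X in _ = _ + X]mulr_suml pi_sum mul1r.
  congr (_ - _ + _).
    under [RHS]eq_bigr do rewrite mulr_sumr.
    (* Through [pi k.+1 *m A k = pi k] the mixed squares recombine into [lyapunov z k]. *)
    rewrite exchange_big/= /lyapunov -pi_A; apply: eq_bigr => j _.
    by rewrite mxE mulr_suml; apply: eq_bigr => i _; rewrite -mulrA.
  by rewrite mulr_sumr; apply: eq_bigr => i _; rewrite mulrCA.
by apply: ler_sum => i _; rewrite ler_wpM2l.
Qed.

(** The reference point of block [t]: with every [f i] evaluated there, only the weights vary over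
    the block and can be averaged. *)
Let y t := x (t * T) i0.

Lemma run_near_ref t s i : (s <= T)%N ->
  enorm (x (t * T + s) i - y t) <= D t + 2 * L * T%:R * a t.
Proof.
move=> sT; apply: (le_trans (run_drift _ _ _ _)).
rewrite lerD2l -[leRHS]mulrAC ler_wpM2l ?ler_nat//.
by rewrite !mulr_ge0// ltW.
Qed.

Lemma mixed_near_ref t s i : (s <= T)%N ->
  enorm (v (t * T + s) i - y t) <= D t + 2 * L * T%:R * a t.
Proof.
move=> sT; have [A0 A1] := A_stoch (t * T + s).
by rewrite vE; apply: enorm_convex_le => // j; exact: run_near_ref.
Qed.

Lemma pi_block t s : pi (t * T + s) = pi s.
Proof.
by elim: t => [|t IH]; rewrite ?add0n// mulSnr addnAC pi_per.
Qed.

Lemma F_lip u w : X u -> X w -> F u - F w <= L * enorm (u - w).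
Proof.
move=> Xu Xw; have TR : 0 < T%:R :> R by rewrite ltr0n.
rewrite -(ler_pM2l TR) mulrBr -!F_avg -sumrB.
rewrite -[T in leRHS]subn0 mulr_natl -sumr_const_nat; apply: ler_sum => s _.
rewrite -sumrB -[leRHS]mul1r -(pi_sum s.+1) mulr_suml; apply: ler_sum => i _.
by rewrite -mulrBr ler_wpM2l// f_lip.
Qed.

Lemma lyapunov_block Delta z t :
  (forall u w, X u -> X w -> enorm (u - w) <= Delta) -> X z ->
  lyapunov z (t.+1 * T) <= lyapunov z (t * T)
    - 2 * T%:R * a t * (F (y t) - F z)
    + T%:R * (2 * L * Delta * (a t - a t.+1) +
              (L + 4 * L ^+ 2 * T%:R + L ^+ 2) * a t ^+ 2 + L * D t ^+ 2).
Proof.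
move=> XDelta Xz; set E := _ + L * D t ^+ 2.
have a0 : 0 <= a t by exact: alpha_ge0.
have step s : (s < T)%N -> lyapunov z (t * T + s).+1 <= lyapunov z (t * T + s)
    - 2 * a t * (\sum_i pi s.+1 0 i * (f i (y t) - f i z)) + E.
  move=> sT; apply: (le_trans (lyapunov_step (t * T + s) Xz)).
  set al := alpha _; set G := D t + 2 * L * T%:R * a t.
  have al_le : al <= a t by rewrite /al /a alpha_noninc// leq_addr.
  have al_ge : a t.+1 <= al.
    by rewrite /al /a alpha_noninc// mulSnr leq_add2l ltnW.
  have al0 : 0 <= al by exact: alpha_ge0.
  rewrite -addnS pi_block.
  set S := \sum_i _; set S' := \sum_i _.
  (* Lipschitz continuity replaces every [v] by [y t] at the price [L * G]. *)
  have SS' : S' - L * G <= S.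
    rewrite /S /S' -[L * G]mul1r -(pi_sum s.+1) mulr_suml -sumrB.
    apply: ler_sum => i _; rewrite -mulrBr ler_wpM2l// lerBlDr.
    have := f_lip i (Xx _ _ : X (y t)) (run_mixed_in (t * T + s) i).
    have : L * enorm (v (t * T + s) i - y t) <= L * G.
      by rewrite ler_wpM2l ?(ltW L_gt0)// mixed_near_ref// ltnW.
    by rewrite enormB; lra.
  have S'_le : S' <= L * Delta.
    rewrite /S' -[leRHS]mul1r -(pi_sum s.+1) mulr_suml.
    apply: ler_sum => i _; rewrite ler_wpM2l//.
    rewrite (le_trans (f_lip _ _ _))// ?ler_wpM2l ?(ltW L_gt0)// ?XDelta//.
    - exact: Xx.
    - exact: Xx.
  have LD0 : 0 <= L * Delta.
    by rewrite mulr_ge0 ?(ltW L_gt0)// (le_trans (enorm_ge0 (z - z)))// XDelta.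
  have D0 : 0 <= D t by exact: spread_ge0.
  rewrite -!addrA lerD2l /E.
  have h1 : al * (S' - L * G) <= al * S by rewrite ler_wpM2l.
  (* This freezes the stepsize at [a t]; bounding [al] below by [a t.+1] prepares a telescoping
     sum. *)
  have h2 : (a t - al) * S' <= (a t - a t.+1) * (L * Delta).
    apply: (@le_trans _ _ ((a t - al) * (L * Delta))).
      by rewrite ler_wpM2l// subr_ge0.
    by rewrite ler_wpM2r// lerD2l lerN2.
  have h3 : al * (L * G) <= a t * (L * G).
    rewrite ler_wpM2r// mulr_ge0 ?(ltW L_gt0)// /G addr_ge0// !mulr_ge0//.
    exact: ltW.
  have h4 : al ^+ 2 * L ^+ 2 <= a t ^+ 2 * L ^+ 2.
    by rewrite ler_wpM2r ?sqr_ge0// ler_sqr.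
  (* Young's inequality splits the mixed term into summable squares. *)
  have h5 : L * (2 * a t * D t) <= L * (a t ^+ 2 + D t ^+ 2).
    by rewrite ler_wpM2l ?(ltW L_gt0)//; have := sqr_ge0 (a t - D t); lra.
  by rewrite /G in h1 h3; lra.
have iter s : (s <= T)%N -> lyapunov z (t * T + s) <= lyapunov z (t * T)
    - 2 * a t * (\sum_(0 <= r < s) \sum_i pi r.+1 0 i * (f i (y t) - f i z))
    + s%:R * E.
  elim: s => [|s IH] sT.
    by rewrite addn0 big_geq// mulr0 mul0r subr0 addr0.
  have := IH (ltnW sT); have := step s sT.
  by rewrite addnS big_nat_recr//= -(natr1 s); lra.
have := iter T (leqnn T); rewrite -mulSnr.
(* Over the full block the weights add up to [T] times those of [F]. *)
have -> : \sum_(0 <= r < T) \sum_i pi r.+1 0 i * (f i (y t) - f i z) =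
    T%:R * (F (y t) - F z).
  rewrite mulrBr -!F_avg -sumrB; apply: eq_bigr => s _.
  by rewrite -sumrB; apply: eq_bigr => i _; rewrite mulrBr.
by lra.
Qed.

(** * Convergence to a minimizer *)

Lemma F_argmin : exists z, X z /\ forall w, X w -> F z <= F w.
Proof. by apply: (lipschitz_argmin L_gt0 cX X0) => u w; exact: F_lip. Qed.

Lemma run_converges : exists z, (X z /\ forall w, X w -> F z <= F w) /\
  forall eps, 0 < eps ->
    exists N, forall k i, (N <= k)%N -> enorm (x k i - z) < eps.
Proof.
have [zs [Xzs zsmin]] := F_argmin.
have [Delta Delta0 XDelta] := compact_diameter cX X0.
have TR : 0 < T%:R :> R by rewrite ltr0n.
have L0 := ltW L_gt0.
have a0 t : 0 <= a t by exact: alpha_ge0.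
pose e t := T%:R * (2 * L * Delta * (a t - a t.+1) +
              (L + 4 * L ^+ 2 * T%:R + L ^+ 2) * a t ^+ 2 + L * D t ^+ 2).
have e0 t : 0 <= e t.
  rewrite mulr_ge0 ?ler0n// !addr_ge0// mulr_ge0 ?sqr_ge0//.
  - by rewrite !mulr_ge0.
  - by rewrite subr_ge0 alpha_noninc// leq_mul2r leqnSn orbT.
  - by rewrite !addr_ge0 ?mulr_ge0 ?sqr_ge0.
have [CD DC] := block_spread_sum.
have [Ca aC] : exists C, forall N, \sum_(0 <= t < N) a t ^+ 2 <= C.
  have [C aC] := alpha_sum2; exists C.
  by apply: (@block_sum_bounded _ (fun k => alpha k ^+ 2)) => // k; exact: sqr_ge0.
(* The differences [a t - a t.+1] telescope to at most [a 0]; both sums of squares are bounded. *)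
have [Ce eC] : exists C, forall N, \sum_(0 <= t < N) e t <= C.
  exists (T%:R * (2 * L * Delta * a 0%N +
              (L + 4 * L ^+ 2 * T%:R + L ^+ 2) * Ca + L * CD)) => N.
  rewrite -mulr_sumr ler_pM2l// !big_split/= -!mulr_sumr !lerD//.
  - rewrite ler_wpM2l ?mulr_ge0//.
    under eq_bigr do rewrite -opprB; rewrite sumrN telescope_sumr// opprB.
    by rewrite gerBl.
  - by rewrite ler_wpM2l// !addr_ge0 ?mulr_ge0 ?sqr_ge0.
  - by rewrite ler_wpM2l.
have descent z t : X z -> lyapunov z (t.+1 * T) <= lyapunov z (t * T)
    - 2 * T%:R * a t * (F (y t) - F z) + e t.
  by move=> Xz; exact: lyapunov_block.
have binf M' : exists N, M' < \sum_(0 <= t < N) 2 * T%:R * a t.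
  have [N NM] := block_sum_unbounded T_gt0 alpha_ge0 alpha_noninc alpha_sum
    (M' / (2 * T%:R)).
  by exists N; rewrite -mulr_sumr mulrC -ltr_pdivrMr// mulr_gt0.
(* Descent relative to the minimizer [zs] makes the gap small along some times that tend to
   infinity. *)
have gap j : exists t, (j <= t)%N /\ F (y t) - F zs < j.+1%:R^-1.
  have [||||t jt tj] := @descent_gap_small _ (fun t => lyapunov zs (t * T))
    (fun t => 2 * T%:R * a t) e (fun t => F (y t) - F zs) Ce _ _ binf _ e0 eC
    j.+1%:R^-1 j; last by exists t.
  - by move=> t; exact: lyapunov_ge0.
  - by move=> t; rewrite !mulr_ge0.
  - by move=> t; exact: descent.
  - by rewrite invr_gt0.
have [tau tauP] := choice gap.
have [z Xz zP] := compact_cluster_seq cX (fun j => Xx (tau j * T) i0).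
have Dsmall := sum_sqr_small (fun t => spread_ge0 (t * T)) DC.
have asmall := sum_sqr_small a0 aC.
(* The cluster point inherits minimality from the values [F (y (tau j))] by the Lipschitz bound. *)
have Fz w : X w -> F z <= F w.
  move=> Xw; apply: (le_trans _ (zsmin _ Xw)).
  apply/ler_addgt0Pr => eps eps0.
  have eps2 : 0 < eps / 2 by rewrite divr_gt0.
  have [N _ NP] := near_infty_natSinv_lt (PosNum eps2).
  have eL : 0 < eps / (2 * L) by rewrite divr_gt0// mulr_gt0.
  have [j Nj] := zP _ N eL; rewrite ltr_pdivlMr ?mulr_gt0// => zj.
  have := NP _ Nj; have := (tauP j).2; have := F_lip Xz (Xx (tau j * T) i0).
  by rewrite /= /y in zj *; move: _^-1 => u; lra.
exists z; split=> // eps eps0.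
have mono t t' : (t <= t')%N ->
    lyapunov z (t' * T) <= lyapunov z (t * T) + \sum_(t <= s < t') e s.
  move=> tt'; have := @descent_sum _ (fun t => lyapunov z (t * T))
    (fun t => 2 * T%:R * a t * (F (y t) - F z)) e
    (fun t => descent z t Xz) t t' tt'.
  apply: le_trans; rewrite lerDl sumr_ge0// => s _.
  by rewrite !mulr_ge0// subr_ge0 Fz//; exact: Xx.
have eps2 : 0 < eps / 2 by rewrite divr_gt0.
(* At block starts agent [i0] has the constant weight [pi 0 0 i0], so a Lyapunov value below [del]
   forces [y t] within [eps / 2] of [z]. *)
pose del := pi 0 0 i0 * (eps / 2) ^+ 2.
have del0 : 0 < del by rewrite mulr_gt0// exprn_gt0.
have [T1 T1P] := sum_tail_small e0 eC (divr_gt0 del0 (ltr0Sn R 1)).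
(* Chosen so that [(2 * r) ^+ 2 <= 4 * r <= del / 2]. *)
pose r := Num.min 1 (del / 8).
have r0 : 0 < r by rewrite lt_min ltr01 divr_gt0.
have [T2 T2P] := Dsmall _ r0.
have [j Nj zj] := zP r (maxn T1 T2) r0.
have tauj : (maxn T1 T2 <= tau j)%N := leq_trans Nj (tauP j).1.
have Vtau : lyapunov z (tau j * T) < del / 2.
  have Dr : D (tau j) < r by apply: T2P; rewrite (leq_trans (leq_maxr _ _) tauj).
  pose q := D (tau j) + enorm (z - y (tau j)).
  have q0 : 0 <= q by rewrite addr_ge0 ?spread_ge0 ?enorm_ge0.
  apply: (@le_lt_trans _ _ (q ^+ 2)).
    rewrite -[leRHS]mul1r -(pi_sum (tau j * T)) mulr_suml; apply: ler_sum => i _.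
    rewrite ler_wpM2l// ler_sqr ?nnegrE ?enorm_ge0//.
    have := enorm_triangle (y (tau j)) (x (tau j * T) i) z.
    by have := enorm_le_spread (tau j * T) i i0; rewrite /q (enormB z) /D /y; lra.
  have q2 : q < 2 * r by rewrite /q /y; lra.
  apply: (@lt_le_trans _ _ ((2 * r) ^+ 2)).
    by rewrite ltr_sqr// nnegrE mulr_ge0// ltW.
  have : r <= 1 by rewrite ge_min lexx.
  have : r <= del / 8 by rewrite ge_min lexx orbT.
  by nra.
have ysmall t : (tau j <= t)%N -> enorm (y t - z) < eps / 2.
  move=> tau_t; have := mono _ _ tau_t.
  have := T1P _ t (leq_trans (leq_maxl _ _) tauj).
  have : pi 0 0 i0 * enorm (y t - z) ^+ 2 <= lyapunov z (t * T).
    have -> : pi 0 = pi (t * T) by rewrite -(pi_block t 0) addn0.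
    rewrite /lyapunov (bigD1 i0)//= lerDl.
    by apply: sumr_ge0 => i _; rewrite mulr_ge0 ?sqr_ge0.
  move=> h1 h2 h3.
  have : pi 0 0 i0 * enorm (y t - z) ^+ 2 < del by lra.
  by rewrite ltr_pM2l// ltr_sqr ?nnegrE ?enorm_ge0// ltW.
have G0 : exists N, forall t, (N <= t)%N -> D t + 2 * L * T%:R * a t < eps / 2.
  have LT : 0 < 2 * L * T%:R by rewrite !mulr_gt0.
  have [N1 N1P] := Dsmall _ (divr_gt0 eps2 (ltr0Sn R 1)).
  have [N2 N2P] := asmall _ (divr_gt0 (divr_gt0 eps2 (ltr0Sn R 1)) LT).
  exists (maxn N1 N2) => t; rewrite geq_max => /andP[/N1P Dt /N2P].
  by rewrite ltr_pdivlMr// mulrC => at_; rewrite /D; lra.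
have [N NP] := G0.
(* Time [k] lies in block [k %/ T], where all agents are within [eps / 2] of [y (k %/ T)]. *)
exists (maxn N (tau j) * T)%N => k i kN.
have : (maxn N (tau j) <= k %/ T)%N by rewrite leq_divRL.
rewrite geq_max => /andP[Nk tk].
have := @run_near_ref (k %/ T) (k %% T) i (ltnW (ltn_pmod k T_gt0)).
rewrite -divn_eq; have := NP _ Nk; have := ysmall _ tk.
by have := enorm_triangle (y (k %/ T)) (x k i) z; lra.
Qed.

End PeriodicRun.

(** * Perron vectors by phase *)

Section PeriodicPerron.
Context {R : realType} {n : nat}.
Variables (A Ap : nat -> 'M[R]_n) (p : nat) (mu : nat -> 'rV[R]_n).
Hypothesis p_gt0 : (0 < p)%N.
Hypothesis A_periodic : forall t l : nat, (1 <= l <= p)%N ->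
  A (t * p + l - 1)%N = Ap l.

Lemma periodic_weightE k : A k = Ap (k %% p).+1.
Proof.
by rewrite -(A_periodic (k %/ p)) ?ltn_pmod// addnS subSS subn0 -divn_eq.
Qed.

Lemma periodic_weight k : A (k + p) = A k.
Proof. by rewrite !periodic_weightE modnDr. Qed.

Lemma periodic_weight_mul k q : A (k + p * q) = A k.
Proof. by rewrite !periodic_weightE addnC mulnC modnMDl. Qed.

(** The residue is that of [k - 1], written without truncated subtraction at [k = 0]; its successor
    numbers the leftmost factor. *)
Lemma cyclic_prodE k : cyclic_prod Ap p (p - (k + p.-1) %% p) = transition A k p.
Proof.
set r := ((k + p.-1) %% p)%N; have rp : (r < p)%N by exact: ltn_pmod.
rewrite /cyclic_prod subKn ?(ltnW rp)// addn1 addn2.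
rewrite -[r.+1 in X in X *m _]add0n (@desc_prod_transition _ _ A); last first.
  by move=> j jr; rewrite periodic_weightE add0n modn_small// (leq_trans jr).
rewrite -[X in desc_prod _ _ X](subnKC rp).
rewrite (@desc_prod_transition _ _ A); last first.
  by move=> j jr; rewrite periodic_weightE modn_small// -ltn_subRL.
(* Moving the left piece from time 0 to time [p] makes the two pieces adjacent. *)
rewrite -(transition_periodic 0 r.+1 periodic_weight) add0n.
have {1}-> : p = (r.+1 + (p - r.+1))%N by rewrite subnKC.
rewrite -transitionD subnK//.
rewrite -(transition_periodic k p periodic_weight).
have -> : (k + p = r.+1 + p * ((k + p.-1) %/ p))%N.
  by have := divn_eq (k + p.-1) p; rewrite -/r; lia.
by rewrite (transition_periodic_mul _ _ _ periodic_weight).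
Qed.

(* [mu l] is the Perron vector of the product over the period that starts at a
   time congruent to [p - l + 1] modulo [p]. *)
Definition phase_perron k := mu (p - (k + p.-1) %% p).

Hypothesis mu_perron : forall l : nat, (1 <= l <= p)%N ->
  is_perron_vector (cyclic_prod Ap p l) (mu l).

Lemma phase_perronP k :
  is_perron_vector (transition A k p) (phase_perron k).
Proof.
rewrite -cyclic_prodE; apply: mu_perron.
by rewrite subn_gt0 ltn_pmod// leq_subr.
Qed.

Lemma phase_perron_periodic k q : phase_perron (k + p * q) = phase_perron k.
Proof. by rewrite /phase_perron addnAC addnC mulnC modnMDl. Qed.

(** Each period meets every [mu l] once, in order of decreasing [l]. *)
Lemma sum_phase_perron q (h : 'I_n -> R) :
  \sum_(0 <= s < p * q) \sum_i phase_perron s.+1 0 i * h i =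
  (p * q)%:R * \sum_i (p%:R^-1 * \sum_(1 <= l < p.+1) mu l 0 i) * h i.
Proof.
have -> : \sum_i (p%:R^-1 * \sum_(1 <= l < p.+1) mu l 0 i) * h i =
    p%:R^-1 * \sum_(1 <= l < p.+1) \sum_i mu l 0 i * h i.
  rewrite exchange_big mulr_sumr; apply: eq_bigr => i _.
  by rewrite -mulrA -mulr_suml.
rewrite natrM mulrAC mulVKf; last by rewrite pnatr_eq0 -lt0n.
rewrite mulnC sum_blocks mulrC mulr_natl -[q in RHS]subn0 -sumr_const_nat.
apply: eq_bigr => t _; rewrite big_nat_rev [RHS]big_add1 /=.
rewrite big_nat [RHS]big_nat; apply: eq_bigr => s /= sp.
apply: eq_bigr => i _; congr (mu _ 0 i * _).
have -> : ((t * p + (0 + p - s.+1)).+1 + p.-1 = t.+1 * p + (p - s.+1))%N.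
  by rewrite mulSn; lia.
by rewrite modnMDl modn_small ?subKn// ltn_subrL.
Qed.
End PeriodicPerron.

(** * Reduction of the algorithm to a periodic run inside [X] *)

Lemma cvg_enorm0 (R : realType) (m : nat) (u : nat -> 'rV[R]_m) :
  (forall eps, 0 < eps -> exists N, forall k, (N <= k)%N -> enorm (u k) < eps) ->
  enorm (u k) @[k --> \oo] --> (0 : R).
Proof.
move=> u0; apply/cvgrPdist_lt => eps /u0[N NP]; exists N => // k /= Nk.
by rewrite sub0r normrN ger0_norm ?enorm_ge0// NP.
Qed.

Theorem theorem3 (R : realType) (m n : nat) (X : set 'rV[R]_m)
    (U : 'I_n -> set 'rV[R]_m) (f : 'I_n -> 'rV[R]_m -> R)
    (L : R) (alpha : nat -> R) (p : nat) (Ap : nat -> 'M[R]_n)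
    (A : nat -> 'M[R]_n) (mu : nat -> 'rV[R]_n)
    (X_nonempty : X !=set0) (X_compact : compact X) (X_convex : convex_set X)
    (U_open : forall i, open (U i)) (U_convex : forall i, convex_set (U i))
    (XU : forall i, X `<=` U i)
    (f_convex : forall i, convex_function (U i) (f i))
    (L_gt0 : 0 < L)
    (L_bound : forall i x d, X x -> subdifferential (U i) (f i) x d ->
                 enorm d <= L)
    (alpha_gt0 : forall k, 0 < alpha k)
    (alpha_noninc : forall k l, (k <= l)%N -> alpha l <= alpha k)
    (alpha_sum : (\sum_(0 <= k <oo) (alpha k)%:E = +oo)%E)
    (alpha_sum2 : (\sum_(0 <= k <oo) (alpha k ^+ 2)%:E < +oo)%E)
    (p_ge2 : (2 <= p)%N)
    (A_periodic : forall t l : nat, (1 <= l <= p)%N ->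
                    A (t * p + l - 1)%N = Ap l)
    (A_weight : weight_rule A) (A_UJSC : UJSC A)
    (mu_perron : forall l : nat, (1 <= l <= p)%N ->
                   is_perron_vector (cyclic_prod Ap p l) (mu l)) :
  achieves_solution X U f alpha A
    (fun x => \sum_i (p%:R^-1 * \sum_(1 <= l < p.+1) mu l 0 i) * f i x).
Proof.
move=> x v d gen; have p0 : (0 < p)%N by exact: ltnW.
have [As [eta [/andP[eta0 _] etaP]]] := A_weight; have [B [B0 sc]] := A_UJSC.
have Adiag k i : 0 < A k i i by rewrite (lt_le_trans eta0)// (etaP k).2.
pose pi := phase_perron p mu.
have piP k := phase_perronP p0 A_periodic mu_perron k.
have pi_sum k : \sum_i pi k 0 i = 1 by have [] := piP k.
(* Entries over an empty index set could not sum to 1. *)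
have [i0 _] : exists i : 'I_n, True.
  apply/not_existsP => H; have := pi_sum 0.
  rewrite big1 => [|i _]; last by case: (H i).
  by move/eqP; rewrite eq_sym oner_eq0.
have n0 : (0 < n)%N by rewrite (leq_ltn_trans _ (ltn_ord i0)).
(* A multiple of [p], for periodicity, and at least [n * B], for positivity, which self-loops carry
   on to [T] steps. *)
pose T := (p * (n * B))%N.
have T0 : (0 < T)%N by rewrite !muln_gt0 p0 n0.
have Tpos k i j : 0 < transition A k T i j.
  have -> : T = (n * B + (T - n * B))%N by rewrite subnKC// leq_pmull.
  rewrite transitionD; apply: (mulmx_entry_gt0 (l := i)).
  - exact: row_stochastic_transition.
  - exact: row_stochastic_transition.
  - exact: transition_diag_gt0.
  - exact: transition_gt0.
have Aper k : A (k + T)%N = A k := periodic_weight_mul p0 A_periodic k (n * B).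
have pi_A k : pi k.+1 *m A k = pi k.
  have [_ _ fix0] := piP k; have [_ _ fix1] := piP k.+1.
  exact: (perron_step (periodic_weight p0 A_periodic) As (Tpos k) (pi_sum _)
    (pi_sum _) fix0 fix1).
(* Initial points are arbitrary, but from time 1 on all iterates lie in [X]. Shifting time by [T]
   ensures this and preserves the phases of [A] and [pi]. *)
have Xx k i : X (x (k + T)%N i).
  rewrite -(prednK T0) addnS; have [_ _ ->] := gen (k + T.-1)%N i.
  exact: (projP _ X_compact X_nonempty).1.
have vE k i : v (k + T)%N i = \sum_j A k i j *: x (k + T)%N j.
  by have [-> _ _] := gen (k + T)%N i; rewrite Aper.
have Xv k i : X (v (k + T)%N i).
  by rewrite vE; apply: convex_set_sum => //; have [] := As k.
have alpha_ge0 k : 0 <= alpha k by exact: ltW.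
have [] := @run_converges R m n X f L (fun k => alpha (k + T)%N) A T pi
  (fun y => \sum_i (p%:R^-1 * \sum_(1 <= l < p.+1) mu l 0 i) * f i y)
  (fun k => x (k + T)%N) (fun k => v (k + T)%N) (fun k => d (k + T)%N) i0 => //.
- by move=> i; exact: (lipschitz_of_subgradient_bound (U_open i) (U_convex i)
    (f_convex i) (XU i) (L_bound i)).
- by move=> k l kl; rewrite alpha_noninc// leq_add2r.
- by apply: unbounded_sum_shift => //; exact: eseries_pinfty_unbounded.
- have sqr0 k : 0 <= alpha k ^+ 2 by exact: sqr_ge0.
  have [C CP] := eseries_fin_bounded sqr0 alpha_sum2.
  exists C => N; apply: (le_trans _ (CP (N + T)%N)).
  rewrite (big_cat_nat (leq0n T) (leq_addl N T))/=.
  by rewrite (sum_shift (fun k => alpha k ^+ 2)) lerDr sumr_ge0.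
- by move=> k i; have [/(_ i)/ltW] := piP k.
- by move=> i; have [] := piP 0%N.
- by move=> k; exact: phase_perron_periodic.
- by move=> y; exact: sum_phase_perron.
- by move=> k i; have [] := gen (k + T)%N i.
- by move=> k i z Xz; have [_ + _] := gen (k + T)%N i; apply; exact: XU.
- by move=> k i; have [_ + _] := gen (k + T)%N i; apply: L_bound; exact: Xv.
move=> z [zmin xz].
have {}xz eps : 0 < eps ->
    exists N, forall k i, (N <= k)%N -> enorm (x k i - z) < eps.
  move=> /xz[N NP]; exists (N + T)%N => k i Nk.
  by rewrite -(subnK (leq_trans (leq_addl N T) Nk)) NP//; lia.
split=> [i j|]; last first.
  exists z; split=> // i; apply: cvg_enorm0 => eps /xz[N NP].
  by exists N => k; exact: NP.
apply: cvg_enorm0 => eps eps0.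
have [N NP] := xz _ (divr_gt0 eps0 (ltr0Sn R 1)).
exists N => k Nk; have := NP _ i Nk; have := NP _ j Nk.
by have := enorm_triangle z (x k i) (x k j); rewrite (enormB z); lra.
Qed.
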